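(* For any $x\in\mathbb{R}^{n_x}$, $\varepsilon>0$, $d\in\mathbb{Z}_{>0}\cup\{\infty\}$, $\mathbf{u}_d\in(\mathbb{R}^{n_u})^d$ and $k\in\mathbb{Z}_{\geq 0}$ with $k\leq d$, $$\phi(k,\lambda^{r}(\varepsilon)x,\Lambda^{q}_{\nu,d}(\varepsilon)\mathbf{u}_{d})=\lambda^{r}(\varepsilon)^{\nu^{k}}\phi(k,x,\mathbf{u}_{d}).$$
   Context: Notation. For $r=(r_1,\dots,r_n)$ with all $r_i>0$, the dilation map is $\lambda^r(\varepsilon)x:=(\varepsilon^{r_1}x_1,\dots,\varepsilon^{r_n}x_n)$ for $\varepsilon>0$, $x\in\mathbb{R}^n$; for a real exponent $s$, $\lambda^r(\varepsilon)^{s}:=\lambda^r(\varepsilon^{s})$. For $d\in\mathbb{Z}_{>0}\cup\{\infty\}$, a sequence of $d$ inputs is $\mathbf{u}_d=(u_0,\dots,u_{d-1})\in(\mathbb{R}^{n_u})^d$ (an infinite sequence if $d=\infty$), and for $c\in\mathbb{R}$, $\Lambda^{q}_{c,d}(\varepsilon)\mathbf{u}_d:=(\lambda^q(\varepsilon)u_0,\lambda^q(\varepsilon)^{c}u_1,\dots,\lambda^q(\varepsilon)^{c^{d-1}}u_{d-1})$, i.e. its $k$-th entry is $\lambda^q(\varepsilon)^{c^k}u_k$. System: $x^+=f(x,u)$ with $f=(f_1,\dots,f_{n_x}):\mathbb{R}^{n_x}\times\mathbb{R}^{n_u}\to\mathbb{R}^{n_x}$, $n_x,n_u\in\mathbb{Z}_{>0}$.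 $\phi(k,x,\mathbf{u}_d)$ is the solution at time $k$ from initial state $x$ with inputs $\mathbf{u}_d$: $\phi(0,x,\mathbf{u}_d)=x$, $\phi(k+1,x,\mathbf{u}_d)=f(\phi(k,x,\mathbf{u}_d),u_k)$. Standing assumption. There are $\nu>0$, $r\in\mathbb{R}_{>0}^{n_x}$, $q\in\mathbb{R}_{>0}^{n_u}$ with $f(\lambda^r(\varepsilon)x,\lambda^q(\varepsilon)u)=\lambda^r(\varepsilon)^{\nu}f(x,u)$ (i.e. $f_i(\lambda^r(\varepsilon)x,\lambda^q(\varepsilon)u)=\varepsilon^{r_i\nu}f_i(x,u)$ for each $i$) for all $x\in\mathbb{R}^{n_x},u\in\mathbb{R}^{n_u},\varepsilon>0$. *)

(* Defs.v *)
From mathcomp Require Import all_boot all_order all_algebra.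
From mathcomp Require Import reals exp.

Set Implicit Arguments.
Unset Strict Implicit.
Unset Printing Implicit Defensive.

Import Order.TTheory GRing.Theory Num.Theory.
Local Open Scope ring_scope.

Inductive horizon := Finite of nat | Infinite.

Definition le_horizon (k : nat) (d : horizon) : bool :=
  if d is Finite n then (k <= n)%N else true.

Lemma le_horizonS (k : nat) (d : horizon) :
  le_horizon k.+1 d -> le_horizon k d.
Proof. by case: d => //= n; exact: ltnW. Qed.

(* The indices 0, ..., d - 1 (all of nat if d is infinite): k < d is
   expressed as k + 1 <= d. *)
Definition time (d : horizon) : Type := {k : nat | le_horizon k.+1 d}.

Definition inputs (R : realType) (n_u : nat) (d : horizon) : Type :=
  time d -> 'rV[R]_n_u.

Definition dilation (R : realType) (n : nat) (r : 'rV[R]_n) (eps : R)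
    (x : 'rV[R]_n) : 'rV[R]_n :=
  \row_i (eps `^ (r 0 i) * x 0 i).

Definition dilation_pow (R : realType) (n : nat) (r : 'rV[R]_n) (eps s : R)
    (x : 'rV[R]_n) : 'rV[R]_n :=
  dilation r (eps `^ s) x.

Definition input_dilation (R : realType) (n_u : nat) (q : 'rV[R]_n_u) (c : R)
    (d : horizon) (eps : R) (u : inputs R n_u d) : inputs R n_u d :=
  fun k => dilation_pow q eps (c ^+ sval k) (u k).

(* The solution at time k exists only for k <= d, so phi takes a proof of this
   bound, from which the membership of each input index in [time d] follows. *)
Fixpoint phi (R : realType) (n_x n_u : nat)
    (f : 'rV[R]_n_x -> 'rV[R]_n_u -> 'rV[R]_n_x) (d : horizon)
    (k : nat) (x : 'rV[R]_n_x) (u : inputs R n_u d) {struct k} :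
    le_horizon k d -> 'rV[R]_n_x :=
  match k with
  | 0 => fun=> x
  | k'.+1 => fun hk => f (phi f x u (le_horizonS hk)) (u (exist _ k' hk))
  end.

(* Main.v *)
Require Import Defs.
From mathcomp Require Import all_boot all_order all_algebra.
From mathcomp Require Import reals exp.

Set Implicit Arguments.
Unset Strict Implicit.
Unset Printing Implicit Defensive.

Import Order.TTheory GRing.Theory Num.Theory.
Local Open Scope ring_scope.

Theorem lemma1 (R : realType) (n_x n_u : nat) (hn_x : (0 < n_x)%N)
    (hn_u : (0 < n_u)%N)
    (f : 'rV[R]_n_x -> 'rV[R]_n_u -> 'rV[R]_n_x)
    (nu : R) (r : 'rV[R]_n_x) (q : 'rV[R]_n_u)
    (hnu : 0 < nu) (hr : forall i, 0 < r 0 i) (hq : forall i, 0 < q 0 i)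
    (hf : forall (x : 'rV[R]_n_x) (u : 'rV[R]_n_u) (eps : R), 0 < eps ->
      f (dilation r eps x) (dilation q eps u) = dilation_pow r eps nu (f x u))
    (x : 'rV[R]_n_x) (eps : R) (heps : 0 < eps)
    (d : horizon) (hd : le_horizon 1 d) (u : inputs R n_u d)
    (k : nat) (hk : le_horizon k d) :
  phi f (dilation r eps x) (input_dilation q nu eps u) hk =
  dilation_pow r eps (nu ^+ k) (phi f x u hk).
Proof.
(* [hk] is generalized so that the induction hypothesis applies to the proof [le_horizonS hk] inside
   [phi]. *)
elim: k hk => [|k IHk] hk /=.
  by rewrite expr0 /dilation_pow powRr1 // ltW.
rewrite IHk {1}/dilation_pow /input_dilation {1}/dilation_pow /=.
rewrite (hf _ _ _ (powR_gt0 (nu ^+ k) heps)).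
(* [exprSr] puts the new factor [nu] on the right, so that [powRrM] makes it the outer exponent. *)
by rewrite /dilation_pow exprSr powRrM.
Qed.
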